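(* Let $q$ be a prime power and let $M$ be a finite matroid. If the lattice $\mathcal{Z}(M)$ of cyclic flats of $M$ is a chain with at least $q+2$ elements, then $M$ is not representable over $\mathrm{GF}(q)$.
   Context: A flat of a matroid is cyclic if it is a (possibly empty) union of circuits. $\mathcal{Z}(M)$ denotes the set of cyclic flats of $M$ ordered by inclusion (a lattice). A chain is a linearly ordered set. *)

(* Defs.v *)
From HB Require Import structures.
From mathcomp Require Import all_boot all_order all_algebra.
Set Implicit Arguments.
Unset Strict Implicit.
Unset Printing Implicit Defensive.

(* A matroid whose ground set is the whole finite type T, given by its
   independent sets. *)
Record matroid (T : finType) := Matroid {
  indep : {set {set T}};
  indep_set0 : set0 \in indep;
  indep_subset : forall I J : {set T},
    J \in indep -> I \subset J -> I \in indep;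
  indep_augment : forall I J : {set T},
    I \in indep -> J \in indep -> #|I| < #|J| ->
    exists2 x, x \in J :\: I & x |: I \in indep
}.

Section MatroidNotions.

Variables (T : finType) (M : matroid T).
Implicit Types (X C F : {set T}).

Definition circuit C : bool := minset [pred X | X \notin indep M] C.

Definition rank X : nat := \max_(I in indep M | I \subset X) #|I|.

Definition closure X : {set T} := [set x | rank (x |: X) == rank X].

Definition flat F : bool := closure F == F.

Definition union_of_circuits X : bool :=
  [exists P : {set {set T}}, [forall C in P, circuit C] && (X == cover P)].

Definition cyclic_flats : {set {set T}} :=
  [set F | flat F & union_of_circuits F].

End MatroidNotions.

Definition inclusion_chain (T : finType) (S : {set {set T}}) : Prop :=
  {in S &, forall A B : {set T}, (A \subset B) || (B \subset A)}.

(* [free] is applied to the family (v x)_(x in X), listed with repetitions: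
   distinct elements of X with the same vector make X dependent. *)
Definition representable (T : finType) (M : matroid T) (K : fieldType) : Prop :=
  exists (r : nat) (v : T -> 'cV[K]_r),
    forall X : {set T}, (X \in indep M) = free [seq v x | x <- enum X].

Definition prime_power (q : nat) : Prop :=
  exists p k : nat, [/\ prime p, 0 < k & q = p ^ k].

(* Main.v *)
(* Walking up the chain one builds, in each cyclic flat G of rank r >= 2, disjoint
   sets B and P with |B| = r - 2 and |P| = m + 1, where m is the number of cyclic
   flats strictly below G, such that B together with any two elements of P is a
   basis of G. Passing from a cyclic flat F to the next one G, the difference
   G \ F has more than r(G) - r(F) elements: r(G) - r(F) of them enlarge B and
   another one enlarges P. Independence is kept because the closure of a circuit
   is a cyclic flat, hence lies inside F or contains G.
   In the largest cyclic flat P has at least q + 2 elements; over GF(q), modulo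
   the span of B, these are pairwise non-parallel vectors in a space of
   dimension 2, which has only q + 1 lines. *)
Require Import Defs.
From HB Require Import structures.
From mathcomp Require Import all_boot all_order all_algebra.
From mathcomp Require Import zify.

Import GRing.Theory.

Set Implicit Arguments.
Unset Strict Implicit.
Unset Printing Implicit Defensive.

(** * Rank, bases, closure and flats *)

Section MatroidTheory.

Variables (T : finType) (M : matroid T).
Implicit Types (x y : T) (X Y I J C F G S Z : {set T}).

Lemma indep_le_rank I X : I \in indep M -> I \subset X -> #|I| <= rank M X.
Proof.
move=> iI sIX; rewrite /rank.
by apply: (@leq_bigmax_cond _ _ (fun I : {set T} => #|I|) I); rewrite iI.
Qed.

Lemma rank_leP X n :
  reflect (forall I, I \in indep M -> I \subset X -> #|I| <= n)
          (rank M X <= n).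
Proof.
apply: (iffP (bigmax_leqP _ _ _)) => [h I iI sI|h I /andP[]]; last exact: h.
by apply: h; rewrite iI.
Qed.

Lemma rankS X Y : X \subset Y -> rank M X <= rank M Y.
Proof.
move=> sXY; apply/rank_leP => I iI sI.
exact: indep_le_rank iI (subset_trans sI sXY).
Qed.

Lemma rank_leD X Y : rank M X <= rank M Y + #|X :\: Y|.
Proof.
apply/rank_leP => I iI sIX; rewrite -(cardsID Y I); apply: leq_add.
  by apply: indep_le_rank (subsetIr _ _); apply: indep_subset iI (subsetIl _ _).
exact/subset_leq_card/setSD.
Qed.

Lemma indep_extend X I : I \in indep M -> I \subset X ->
  exists J, [/\ I \subset J, J \in indep M, J \subset X & #|J| = rank M X].
Proof.
move=> iI sIX.
pose Q := [pred J : {set T} | (J \in indep M) && (J \subset X)].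
have [|J /maxsetP[/andP[/= iJ sJX] maxJ] sIJ] := @maxset_exists _ Q I.
  by rewrite /= iI.
exists J; split=> //; apply/eqP; rewrite eqn_leq indep_le_rank //=.
apply/rank_leP => I' iI' sI'X; rewrite leqNgt; apply/negP => ltJ.
have [x /setDP[xI' xJ] ixJ] := indep_augment iJ iI' ltJ.
have := maxJ (x |: J); rewrite /= ixJ subUset sub1set (subsetP sI'X) //= sJX.
by move=> /(_ isT (subsetUr _ _)) eqJ; rewrite -eqJ setU11 in xJ.
Qed.

Lemma rank_basis X : exists2 J, J \in indep M & J \subset X /\ #|J| = rank M X.
Proof.
have [J [_ iJ sJ cJ]] := indep_extend (indep_set0 M) (sub0set X).
by exists J.
Qed.

Lemma rank_add1 X x J : J \in indep M -> J \subset X -> #|J| = rank M X ->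
  rank M X < rank M (x |: X) -> x |: J \in indep M.
Proof.
move=> iJ sJX cJ ltr.
have [I iI [sI cI]] := rank_basis (x |: X).
have [|y /setDP[yI yJ] iyJ] := indep_augment iJ iI; first by rewrite cJ cI.
have [->//|nyx] := eqVneq x y.
have yX : y \in X.
  by have := subsetP sI y yI; rewrite !inE eq_sym (negPf nyx).
have := indep_le_rank (X := X) iyJ.
by rewrite subUset sub1set yX sJX cardsU1 yJ cJ ltnn => /(_ isT).
Qed.

(** This trades an equality of ranks for an independence test against one fixed basis; the
    properties of closure below are all derived through it. *)
Lemma closure_basisP X J x : J \in indep M -> J \subset X -> #|J| = rank M X ->
  x \notin J -> (x \in Defs.closure M X) = (x |: J \notin indep M).
Proof.
move=> iJ sJX cJ xJ; rewrite inE eqn_leq (rankS (subsetUr _ _)) andbT.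
rewrite leqNgt; congr (~~ _); apply/idP/idP; first exact: rank_add1 iJ sJX cJ.
move=> ixJ; have := indep_le_rank (X := x |: X) ixJ (setUS _ sJX).
by rewrite cardsU1 xJ cJ.
Qed.

Lemma sub_closure X : X \subset Defs.closure M X.
Proof. by apply/subsetP => x xX; rewrite inE (setUidPr _) ?sub1set. Qed.

Lemma rank_closure X : rank M (Defs.closure M X) = rank M X.
Proof.
apply/eqP; rewrite eqn_leq (rankS (sub_closure X)) andbT.
have [J iJ [sJX cJ]] := rank_basis X.
apply/rank_leP => I iI sI; rewrite -cJ leqNgt; apply/negP => ltJ.
have [x /setDP[xI xJ]] := indep_augment iJ iI ltJ.
by apply/negP; rewrite -(closure_basisP iJ sJX cJ) // (subsetP sI).
Qed.

Lemma flat_closure X : flat M (Defs.closure M X).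
Proof.
rewrite /flat eqEsubset sub_closure andbT; apply/subsetP => x.
have [J iJ [sJX cJ]] := rank_basis X.
have sJc := subset_trans sJX (sub_closure X).
have [/(subsetP sJc)//|xJ] := boolP (x \in J).
rewrite (closure_basisP iJ sJX cJ) // (closure_basisP iJ sJc) //.
by rewrite rank_closure.
Qed.

Lemma flat_rank_lt F G : flat M F -> F \proper G -> rank M F < rank M G.
Proof.
move=> /eqP fF /properP[sFG [x xG xF]].
apply: (@leq_trans (rank M (x |: F))); last first.
  by apply: rankS; rewrite subUset sub1set xG.
rewrite ltn_neqAle (rankS (subsetUr _ _)) andbT eq_sym.
by apply: contra xF => h; rewrite -fF inE.
Qed.

Lemma closure_sub_flat X F :
  flat M F -> X \subset F -> Defs.closure M X \subset F.
Proof.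
move=> /eqP fF sXF; apply/subsetP => x xX; rewrite -fF.
have [J iJ [sJX cJ]] := rank_basis X.
have [xJ|xJ] := boolP (x \in J).
  by apply: (subsetP (sub_closure F)); rewrite (subsetP sXF) ?(subsetP sJX).
have [I [sJI iI sIF cI]] := indep_extend iJ (subset_trans sJX sXF).
have [xI|xI] := boolP (x \in I).
  exact: (subsetP (sub_closure F)) (subsetP sIF x xI).
rewrite (closure_basisP iI sIF cI) //.
apply: contraL xX => ixI; rewrite (closure_basisP iJ sJX cJ) ?negbK //.
exact: indep_subset ixI (setUS _ sJI).
Qed.

(** * Circuits and cyclic flats *)

Lemma circuitP C : reflect
  (C \notin indep M /\ forall I, I \proper C -> I \in indep M) (circuit M C).
Proof.
apply: (iffP minsetP) => [[/= dC minC]|[dC minC]]; split=> //.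
  move=> I pIC; apply/negPn/negP => dI.
  by have := pIC; rewrite (minC I dI (proper_sub pIC)) properxx.
move=> I /= dI sIC; apply/eqP; rewrite eqEproper sIC /=.
by apply: contra dI => /minC.
Qed.

Lemma dependent_circuit X : X \notin indep M ->
  exists2 C, circuit M C & C \subset X.
Proof.
move=> dX; have [C mC sC] := @minset_exists _ [pred X | X \notin indep M] X dX.
by exists C.
Qed.

Lemma circuit_rank C : circuit M C -> rank M C < #|C|.
Proof.
move=> /circuitP[dC _]; have [J iJ [sJC <-]] := rank_basis C.
apply: proper_card; rewrite properEneq sJC andbT.
by apply: contraNneq dC => <-.
Qed.

Lemma union_of_circuitsP X : reflect
  (forall x, x \in X -> exists C, [/\ circuit M C, x \in C & C \subset X])
  (union_of_circuits M X).
Proof.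
apply: (iffP existsP) => [[P /andP[/forall_inP cP /eqP ->]] x|h].
  case/bigcupP => C CP xC; exists C; split=> //; first exact: cP.
  exact: (bigcup_sup C).
exists [set C : {set T} | circuit M C && (C \subset X)]; apply/andP; split.
  by apply/forall_inP => C; rewrite inE => /andP[].
rewrite eqEsubset; apply/andP; split.
  apply/subsetP => x /h[C [cC xC sCX]].
  by apply/bigcupP; exists C; rewrite ?inE ?cC.
by apply/bigcupsP => C; rewrite inE => /andP[].
Qed.

(** A point added by the closure lies on its fundamental circuit with respect to a basis of [X], and
    this circuit stays inside the closure. *)
Lemma closure_cyclic_flat X :
  union_of_circuits M X -> Defs.closure M X \in cyclic_flats M.
Proof.
move=> /union_of_circuitsP uX; rewrite inE flat_closure /=.
apply/union_of_circuitsP => x xc; have [xX|xX] := boolP (x \in X).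
  have [C [cC xC sCX]] := uX x xX; exists C; split=> //.
  exact: subset_trans sCX (sub_closure X).
have [J iJ [sJX cJ]] := rank_basis X.
have xJ : x \notin J by apply: contra xX; apply: subsetP sJX x.
have [|C cC sC] := @dependent_circuit (x |: J).
  by rewrite -(closure_basisP iJ sJX cJ).
exists C; split=> //; last first.
  apply: subset_trans sC _; rewrite subUset sub1set xc.
  exact: subset_trans sJX (sub_closure X).
have [dC _] := circuitP _ cC; apply: contraNT dC => xC.
apply: indep_subset iJ _; apply/subsetP => y yC.
have := subsetP sC y yC; rewrite !inE; case: eqP => // eyx.
by rewrite -eyx yC in xC.
Qed.

Lemma circuit_closure_cyclic_flat C :
  circuit M C -> Defs.closure M C \in cyclic_flats M.
Proof.
move=> cC; apply/closure_cyclic_flat/union_of_circuitsP => x xC.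
by exists C.
Qed.

(** Extend the independent set [C :\ x] to a basis [J] of [G :\ x]. If restoring [x] raised the
    rank, [x |: J] would be independent while containing [C]. *)
Lemma rankD1_circuit G C x : circuit M C -> x \in C -> C \subset G ->
  rank M (G :\ x) = rank M G.
Proof.
move=> /circuitP[dC minC] xC sCG; apply/eqP.
rewrite eqn_leq (rankS (subD1set _ _)) /=.
have [J [sJ iJ sJG cJ]] :=
  indep_extend (minC _ (properD1 xC)) (setSD [set x] sCG).
rewrite leqNgt; apply: contra dC => ltr.
have ixJ : x |: J \in indep M.
  by apply: (rank_add1 iJ sJG cJ); rewrite setD1K // (subsetP sCG).
by apply: indep_subset ixJ _; rewrite -(setD1K xC) setUS.
Qed.

(** Some [x] in [G :\: F] lies on a circuit of [G], so it can be deleted before counting without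
    lowering the rank. The strict inequality supplies the spare element that enlarges [P] at each
    step of the chain. *)
Lemma cyclic_nullity_lt F G : union_of_circuits M G -> F \proper G ->
  rank M G < rank M F + #|G :\: F|.
Proof.
move=> /union_of_circuitsP uG /properP[_ [x xG xF]].
have [C [cC xC sCG]] := uG x xG.
rewrite -(rankD1_circuit cC xC sCG) (cardsD1 x (G :\: F)) inE xF xG addnCA.
rewrite add1n ltnS; apply: leq_trans (rank_leD _ F) _.
by rewrite leq_add2l subset_leq_card // setDDl setDDl setUC.
Qed.

(* A circuit of [I :|: S] spans a cyclic flat [Z]. If [Z \subset F] then the
   circuit lies in [I]; if [G \subset Z] then the circuit is too large. *)
Lemma indepU_gap F G I S :
  {in cyclic_flats M, forall Z, (Z \subset F) || (G \subset Z)} ->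
  I \in indep M -> S \subset G :\: F -> #|I :|: S| <= rank M G ->
  I :|: S \in indep M.
Proof.
move=> gap iI sS leIS; apply/negPn/negP => /dependent_circuit[C cC sC].
have [dC _] := circuitP _ cC.
have /orP[sZF|sGZ] := gap _ (circuit_closure_cyclic_flat cC).
  have sCF := subset_trans (sub_closure C) sZF.
  move/negP: dC; apply; apply: indep_subset iI _; apply/subsetP => x xC.
  have := subsetP sC x xC; rewrite inE => /orP[//|/(subsetP sS)].
  by rewrite inE (subsetP sCF).
have := rankS sGZ; rewrite rank_closure.
have := circuit_rank cC; have := subset_leq_card sC; lia.
Qed.

(** * Building pencils along the chain of cyclic flats *)

Lemma subset_of_card (A : {set T}) n :
  n <= #|A| -> exists2 S : {set T}, S \subset A & #|S| = n.
Proof.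
move=> /card_geqP[s [us <- sA]]; exists [set x in s].
  by apply/subsetP => x; rewrite inE => /sA.
by rewrite cardsE; apply/card_uniqP.
Qed.

Lemma cardsU_disjoint X Y : [disjoint X & Y] -> #|X :|: Y| = #|X| + #|Y|.
Proof. by move=> dXY; apply/eqP; rewrite (leq_card_setU X Y). Qed.

(* When [rank M F >= 2], contracting [B] turns [P] into a set of [m.+1] pairwise
   non-parallel points of rank 2. The truncated subtraction makes the same
   invariant hold for [F] of rank 0 and 1, where it starts. *)
Definition pencil F m (B P : {set T}) : Prop :=
  [/\ [disjoint B & P], B :|: P \subset F, #|B| = rank M F - 2,
      #|P| = m + (1 < rank M F) &
      forall D : {set T}, D \subset P -> #|D| <= 2 -> B :|: D \in indep M].

Lemma pencil_step F G m B P :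
    flat M F -> union_of_circuits M G -> F \proper G ->
    {in cyclic_flats M, forall Z, (Z \subset F) || (G \subset Z)} ->
  pencil F m B P -> exists B' P', pencil G m.+1 B' P'.
Proof.
move=> fF uG pFG gap [dBP sBPF cB cP iBP].
have ltr := flat_rank_lt fF pFG; have ltn := cyclic_nullity_lt uG pFG.
set r := rank M F in ltr ltn cB cP; set r' := rank M G in ltr ltn.
(* This serves the case [r' = 1]: then [r = 0], hence [m = 0], and the new [P] has a single element,
   so the final cardinality bound still holds. *)
have P0 : r = 0 -> #|P| = 0.
  move=> r0; apply/eqP; rewrite cards_eq0 -subset0; apply/subsetP => x xP.
  have := iBP [set x]; rewrite sub1set xP cards1 => /(_ isT isT) ixB.
  have := indep_le_rank (X := F) ixB; rewrite -/r r0 leqn0 cards_eq0.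
  rewrite (subset_trans _ sBPF) ?setUS ?sub1set // => /(_ isT) /eqP E.
  by have := in_set0 x; rewrite -E !inE eqxx orbT.
have [SB sSB cSB] : exists2 S : {set T},
    S \subset G :\: F & #|S| = (r' - 2) - (r - 2).
  by apply: subset_of_card; lia.
(* One element accounts for the new cyclic flat, a second one for the rank passing from below 2 to
   at least 2. In the latter case [SB] has only [r' - 2] elements, and [G :\: F] has at least
   [r' - r + 1 >= r']. *)
have [SP sSP cSP] : exists2 S : {set T},
    S \subset (G :\: F) :\: SB & #|S| = 1 + ((r < 2) && (1 < r')).
  apply: subset_of_card; rewrite cardsD (setIidPr sSB); lia.
move: sSB sSP; rewrite !subsetD => /andP[sBG dBF] /andP[/andP[sPG dPF] dPB].
move: sBPF; rewrite subUset => /andP[sBF sPF].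
have disjF X Y : X \subset F -> [disjoint Y & F] -> [disjoint X & Y].
  by move=> sXF dYF; rewrite disjoint_sym (disjointWr sXF).
exists (B :|: SB), (P :|: SP).
have cB' : #|B :|: SB| = r' - 2.
  by rewrite cardsU_disjoint ?cB ?cSB; [clear - ltr; lia | exact: disjF].
have cP' : #|P :|: SP| = m.+1 + (1 < r').
  by rewrite cardsU_disjoint ?cP ?cSP; [clear - ltr; lia | exact: disjF].
have sFG := proper_sub pFG.
split=> //.
- have dU X Y Z :
      [disjoint X & Z] -> [disjoint Y & Z] -> [disjoint X :|: Y & Z].
    by rewrite -!setI_eq0 setIUl setU_eq0 => -> ->.
  apply: (dU); rewrite disjoint_sym; apply: (dU) => //.
  - by rewrite disjoint_sym.
  - by rewrite disjoint_sym; apply: disjF.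
  - exact: disjF.
- by rewrite !subUset sBG sPG !(subset_trans _ sFG).
move=> D sD cD.
(* The part inside [F] is independent by the pencil of [F]; the rest lies in [G :\: F], as
   [indepU_gap] requires. *)
have -> : B :|: SB :|: D = (B :|: (D :&: F)) :|: (SB :|: (D :\: F)).
  by rewrite setUACA setID.
apply: (indepU_gap gap).
- apply: iBP; last exact: leq_trans (subset_leq_card (subsetIl _ _)) cD.
  apply/subsetP => x /setIP[/(subsetP sD)/setUP[//|xSP] xF].
  by rewrite (disjointFr dPF xSP) in xF.
- rewrite subUset subsetD sBG dBF setSD //=; apply: subset_trans sD _.
  by rewrite subUset (subset_trans sPF).
rewrite setUACA setID -/r'.
have := subset_leq_card sD; rewrite cP' => cDP.
have := leq_card_setU (B :|: SB) D => -[+ _]; rewrite cB'.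
move: P0; rewrite cP; move: (#|_ :|: _|) (#|D|) cD cDP => n d cD cDP.
clear - ltr cD cDP; lia.
Qed.

Lemma pencil_exists G : inclusion_chain (cyclic_flats M) ->
  G \in cyclic_flats M ->
  exists B P, pencil G #|[set Z in cyclic_flats M | Z \proper G]| B P.
Proof.
move=> chain; have [n] := ubnP #|G|; elim: n G => // n IHn G ltGn cG.
have /[!inE]/andP[fG uG] := cG.
pose L G := [set Z in cyclic_flats M | Z \proper G].
have [L0|[F0 LF0]] := set_0Vmem (L G).
  (* The closure of the empty set is a cyclic flat inside [G]; as it is not strictly below [G], it
     equals [G]. *)
  have rG0 : rank M G = 0.
    have c0 : Defs.closure M set0 \in cyclic_flats M.
      by apply/closure_cyclic_flat/union_of_circuitsP => x; rewrite inE.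
    have s0 := closure_sub_flat fG (sub0set G).
    have: Defs.closure M set0 \notin L G by rewrite L0 inE.
    rewrite inE c0 properE s0 /= negbK => sG.
    apply/eqP; rewrite -leqn0; apply: leq_trans (rankS sG) _.
    rewrite rank_closure; apply/rank_leP => I _.
    by rewrite subset0 => /eqP ->; rewrite cards0.
  exists set0, set0; rewrite -/(L G) L0; split.
  - by rewrite -setI_eq0 setI0.
  - by rewrite setU0 sub0set.
  - by rewrite rG0 cards0.
  - by rewrite rG0 !cards0.
  move=> D; rewrite subset0 => /eqP -> _; rewrite setU0; exact: indep_set0.
(* [F] is the predecessor of [G]: in a chain, a cyclic flat not inside [F] and not containing [G]
   would lie strictly between them and be larger than [F]. *)
have [F /= LF maxF] :=
  @arg_maxnP _ F0 [in L G] (fun F : {set T} => #|F|) LF0.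
move: (LF); rewrite inE => /andP[cF pFG].
have gap : {in cyclic_flats M, forall Z, (Z \subset F) || (G \subset Z)}.
  move=> Z cZ; have [//|nZF] /= := boolP (Z \subset F).
  have pFZ : F \proper Z.
    by rewrite properE nZF andbT; have := chain Z F cZ cF; rewrite (negPf nZF).
  have := chain Z G cZ cG; case: (boolP (G \subset Z)) => // nGZ /[!orbF] sZG.
  have := maxF Z; rewrite inE cZ properE sZG nGZ => /(_ isT).
  by rewrite leqNgt proper_card.
have LE : #|L G| = #|L F|.+1.
  rewrite (cardsD1 F) LF add1n; congr _.+1; apply: eq_card => Z.
  rewrite !inE; have [->|nZF] := eqVneq Z F; first by rewrite properxx andbF.
  case cZ : (Z \in cyclic_flats M); rewrite !inE in cZ; rewrite cZ //=.
  apply/idP/idP => [pZG|/proper_trans]; last exact.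
  rewrite properEneq nZF /=; have := gap Z; rewrite !inE cZ.
  move=> /(_ isT)/orP[//|sGZ].
  by have := proper_sub_trans pZG sGZ; rewrite properxx.
have [|//|B [P pF]] := IHn F; first exact: leq_trans (proper_card pFG) ltGn.
move: cF; rewrite inE => /andP[fF uF]; rewrite -/(L G) LE.
exact: pencil_step fF uG pFG gap pF.
Qed.

End MatroidTheory.

(** * Pencils in a matroid represented over a finite field *)

Section RepresentedMatroid.

Variables (K : finFieldType) (V : vectType K) (T : finType) (M : matroid T).
Variable v : T -> V.
Hypothesis repr_v : forall X : {set T},
  (X \in indep M) = free [seq v x | x <- enum X].

Let sp (X : {set T}) := <<[seq v x | x <- enum X]>>%VS.

Lemma span_setU1 x (X : {set T}) : sp (x |: X) = (<[v x]> + sp X)%VS.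
Proof.
rewrite -span_cons; apply: (@eq_span _ _ _ (map v (x :: enum X))).
by apply: eq_mem_map => y; rewrite inE !mem_enum !inE.
Qed.

Lemma dim_span_indep (X : {set T}) : X \in indep M -> \dim (sp X) = #|X|.
Proof. by rewrite repr_v => /eqP ->; rewrite size_map -cardE. Qed.

Lemma mem_span_basis (G J : {set T}) x :
  J \in indep M -> J \subset G -> #|J| = rank M G -> x \in G -> v x \in sp J.
Proof.
move=> iJ sJG cJ xG; have [xJ|xJ] := boolP (x \in J).
  by apply: memv_span; apply: map_f; rewrite mem_enum.
have: x |: J \notin indep M.
  apply/negP => ixJ; have := indep_le_rank (X := G) ixJ.
  by rewrite subUset sub1set xG sJG cardsU1 xJ cJ ltnn => /(_ isT).
rewrite repr_v.
have /(perm_map v) : perm_eq (enum (x |: J)) (x :: enum J).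
  apply: uniq_perm; rewrite ?enum_uniq //= ?enum_uniq ?mem_enum ?xJ //.
  by move=> y; rewrite inE !mem_enum !inE.
by move/perm_free ->; rewrite /= free_cons -repr_v iJ andbT negbK.
Qed.

(** Fix [p0] and [p1] in [P] as coordinates modulo [W]. With [p0] as the point at infinity, every
    other point of [P] gets a slope in [K], and distinct points get distinct slopes. *)
Lemma pencil_card_le (G : {set T}) m (B P : {set T}) :
  1 < rank M G -> pencil M G m B P -> #|P| <= #|K|.+1.
Proof.
move=> rG [dBP sBPG cB _ iBP]; set W := sp B.
have [->|[p0 p0P]] := set_0Vmem P; first by rewrite cards0.
have [P0|[p1 p1P]] := set_0Vmem (P :\ p0).
  by rewrite (cardsD1 p0) P0 cards0 p0P.
have pair (p p' : T) : p \in P -> p' \in P -> p != p' ->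
    [/\ p |: (p' |: B) \in indep M, p |: (p' |: B) \subset G,
        #|p |: (p' |: B)| = rank M G &
        sp (p |: (p' |: B)) = (<[v p]> + (<[v p']> + W))%VS].
  move=> pP p'P npp'; have sG := subsetP (subset_trans (subsetUr _ _) sBPG).
  rewrite !span_setU1; split=> //.
  - rewrite setUA setUC; apply: iBP; last by rewrite cards2; case: (_ != _).
    by rewrite subUset !sub1set pP.
  - rewrite !subUset !sub1set !sG //=.
    exact: subset_trans (subsetUl _ _) sBPG.
  rewrite !cardsU1 !inE (negPf npp') /= !(disjointFl dBP) // cB; lia.
(* Non-parallelism modulo [W]: two points of [P] together with [B] form a basis of [G], so their
   vectors do not fit in a smaller space. *)
have dimpair (U : {vspace V}) p p' : \dim U < rank M G -> (W <= U)%VS ->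
    p \in P -> p' \in P -> p != p' -> v p \in U -> v p' \in U -> False.
  move=> dU sWU pP p'P npp' pU p'U; have [iX _ cX eX] := pair p p' pP p'P npp'.
  have := dim_span_indep iX; rewrite cX eX => dX.
  suff /dimvS : (<[v p]> + (<[v p']> + W) <= U)%VS by rewrite dX leqNgt dU.
  by rewrite !subv_add -!memvE pU p'U.
have dimW u : \dim (<[u]> + W) < rank M G.
  have dW : \dim W = rank M G - 2.
    rewrite -cB /W dim_span_indep //; apply: indep_subset (iBP set0 _ _) _.
    - exact: sub0set.
    - by rewrite cards0.
    exact: subsetUl.
  have := dimv_add_leqif <[u]> W => -[+ _]; rewrite dW dim_vline.
  case: (u != 0)%R; lia.
move: p1P => /setD1P[np10 p1P].
(* [f p] is the slope of [p]; by [fP] the default value is never reached on [P :\ p0]. *)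
pose f p := odflt 0%R [pick c | v p \in (<[v p1 + c *: v p0]> + W)%VS].
have fP p : p \in P :\ p0 -> v p \in (<[v p1 + f p *: v p0]> + W)%VS.
  move=> /setD1P[np0 pP]; rewrite /f; case: pickP => //= noc; exfalso.
  have [iJ sJ cJ eJ] := pair _ _ p1P p0P np10.
  have := mem_span_basis iJ sJ cJ (x := p).
  rewrite eJ (subsetP sBPG) ?inE ?pP ?orbT // => /(_ isT).
  case/memv_addP => _ /vlineP[b ->] [_ /memv_addP[_ /vlineP[a ->] [w wW ->]] E].
  (* If the coefficient of [v p1] vanishes, [p] is parallel to [p0] modulo [W], which is excluded;
     otherwise the slope is [a / b]. *)
  have [b0|b0] := eqVneq b 0%R.
    apply: (dimpair _ p p0 (dimW (v p0))) => //; rewrite ?addvSr //.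
    - by rewrite E b0 scale0r add0r memv_add // memvZ // memv_line.
    - by rewrite memvE addvSl.
  have /negP[] := noc (a / b)%R; rewrite E addrA; apply: memv_add => //.
  suff -> : (b *: v p1 + a *: v p0 = b *: (v p1 + (a / b) *: v p0))%R.
    by rewrite memvZ // memv_line.
  by rewrite scalerDr scalerA mulrC divfK.
rewrite (cardsD1 p0) p0P add1n ltnS -(card_in_imset (f := f)) ?max_card //.
move=> p p' pP p'P Ef; apply/eqP/negPn/negP => npp'.
have := fP _ pP; have := fP _ p'P; rewrite Ef => p'U pU.
move: pP p'P => /setD1P[_ pP] /setD1P[_ p'P].
exact: dimpair (dimW _) (addvSr _ _) pP p'P npp' pU p'U.
Qed.

End RepresentedMatroid.

Theorem theorem2p3 (q : nat) (hq : prime_power q)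
    (K : finFieldType) (hK : #|K| = q)
    (T : finType) (M : matroid T)
    (hchain : inclusion_chain (cyclic_flats M))
    (hcard : q + 2 <= #|cyclic_flats M|) :
  ~ representable M K.
Proof.
move=> [r [v repr_v]].
have [G0 cG0] : exists G0, G0 \in cyclic_flats M.
  by apply/set0Pn; rewrite -card_gt0; lia.
have [G /= cG maxG] :=
  @arg_maxnP _ G0 [in cyclic_flats M] (fun F : {set T} => #|F|) cG0.
have [B [P pG]] := pencil_exists hchain cG.
set m := #|_| in pG.
(* A cyclic flat of largest cardinality is the top of the chain, so all the others lie strictly
   below it and [m] is at least [q + 1]. *)
have cM : #|cyclic_flats M| = m.+1.
  rewrite (cardsD1 G) cG add1n; congr _.+1; apply: eq_card => Z.
  rewrite in_setD1 [in RHS]inE andbC; case cZ: (Z \in cyclic_flats M) => //=.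
  rewrite properEcard; have [->|nZG] /= := eqVneq Z G.
    by rewrite ltnn andbF.
  have sZG : Z \subset G.
    have /orP[//|sGZ] := hchain Z G cZ cG.
    by have /eqP <- : G == Z by rewrite eqEcard sGZ; apply: maxG.
  by rewrite sZG ltn_neqAle; move: nZG; rewrite eqEcard sZG /= -ltnNge; lia.
have q1 : 1 < q by rewrite -hK; apply: card_finNzRing_gt1.
have [_ sBPG _ cP iBP] := pG.
(* [P] has at least two elements, and any two of them are independent in [G]. *)
have rG : 1 < rank M G.
  rewrite ltnNge; apply/negP => rG.
  have [|D sDP cD] := @subset_of_card T P 2; first by lia.
  have := indep_le_rank (X := G) (iBP D sDP _); rewrite cD => /(_ isT).
  have sD : B :|: D \subset G by apply: subset_trans sBPG; apply: setUS.
  move=> /(_ sD); have := subset_leq_card (subsetUr B D); lia.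
(* Here [P] has [m + 1 >= q + 2] elements, against the bound [q + 1]. *)
have := pencil_card_le repr_v rG pG; rewrite cP rG; lia.
Qed.
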